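(* Let $H$ be a nonzero complex Hilbert space and let $V\subseteq\{\xi\in H:\|\xi\|=1\}$ be a norm-closed set satisfying V1: $\lambda\cdot V\subseteq V$ for every $\lambda\in\mathbb C$ with $|\lambda|=1$; and V2: for $\xi\in H$, if $\langle\xi,\eta\rangle=0$ for all $\eta\in V$ then $\xi=0$. Then for every $\xi\in H$ with $\|\xi\|=1$ one has $\|\xi\|^V\ge1$, and $\|\xi\|^V=1$ if and only if $\xi\in V$.
   Context: For $\xi\in H$ define $\|\xi\|_V=\sup_{\eta\in V}|\langle\xi,\eta\rangle|$ and $\|\xi\|^V=\sup\{|\langle\xi,\eta\rangle|:\eta\in H,\ \|\eta\|_V\le1\}\in[0,+\infty]$. *)

(* Defs.v *)
From HB Require Import structures.
From mathcomp Require Import all_boot all_order all_algebra.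
From mathcomp Require Import sesquilinear complex.
From mathcomp Require Import all_classical all_reals all_analysis.

Set Implicit Arguments.
Unset Strict Implicit.
Unset Printing Implicit Defensive.

Import Order.TTheory GRing.Theory Num.Theory.
Import numFieldNormedType.Exports.

Local Open Scope classical_set_scope.
Local Open Scope ring_scope.

Section norms.
Variables (R : realType) (H : lmodType R[i]).
Variables (ip : H -> H -> R[i]) (V : set H).

(* `|z| is valued in R[i] in MathComp; [complex.Re] recovers the real modulus. *)
Definition modulus (z : R[i]) : R := complex.Re `|z|.

(* ||xi||_V. With values in \bar R: finite as soon as V is nonempty and
   bounded (the supremum over the empty set is -oo). *)
Definition norm_sub (xi : H) : \bar R :=
  ereal_sup [set (modulus (ip xi eta))%:E | eta in V].

(* ||xi||^V *)
Definition norm_sup (xi : H) : \bar R :=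
  ereal_sup [set (modulus (ip xi eta))%:E
            | eta in [set eta | (norm_sub eta <= 1)%E]].

End norms.

(* Main.v *)
(* If [norm_sup xi = 1], testing against multiples of [xi] itself yields
   [v] in [V] with [|<xi, v>|] arbitrarily close to 1. After multiplying [v] by
   a unit scalar, which V1 allows, [<xi, v>] is nonnegative, so
   [|xi - v|^2 = 2 - 2 <xi, v>] is arbitrarily small, and [xi] lies in [V]
   because [V] is closed. *)
Require Import Defs.
From HB Require Import structures.
From mathcomp Require Import all_boot all_order all_algebra.
From mathcomp Require Import sesquilinear complex.
From mathcomp Require Import all_classical all_reals all_analysis.
From mathcomp Require Import ring.

Set Implicit Arguments.
Unset Strict Implicit.
Unset Printing Implicit Defensive.

Import Order.TTheory GRing.Theory Num.Theory.
Import numFieldNormedType.Exports.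

Local Open Scope classical_set_scope.
Local Open Scope ring_scope.

Lemma modulus_le (R : realType) (z : R[i]) (r : R) :
  (modulus z <= r) = (`|z| <= r%:C%C).
Proof. by rewrite -lecR /modulus RRe_real ?normr_real. Qed.

(** Cauchy-Schwarz for unit vectors: subtracting from [u] its projection onto [v] leaves a vector of
    squared norm [1 - |form u v|^2], which is nonnegative. *)
Lemma dot_le1 (C : numClosedFieldType) (U : lmodType C)
    (form : {dot U for (@Num.conj C)}) (u v : U) :
  form u u = 1 -> form v v = 1 -> `|form u v| <= 1.
Proof.
move=> u1 v1; rewrite -(@expr_le1 _ 2) //.
have := dnorm_ge0 form (u - form u v *: v).
rewrite dnormB dnormZ u1 v1 linearZr_LR /= [_ * form u v]mulrC -normCK.
rewrite (CrealP _) ?rpredX ?normr_real // mulr1 opprD addrA addrK.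
by rewrite subr_ge0.
Qed.

(* Among the unit multiples of [v], the one whose product with [u] is
   nonnegative is the closest to [u]. *)
Lemma dot_rotate (C : numClosedFieldType) (U : lmodType C)
    (form : {dot U for (@Num.conj C)}) (u v : U) :
    form u v != 0 -> form u u = 1 -> form v v = 1 ->
  let w := (form u v / `|form u v|) *: v in
  form (u - w) (u - w) = 2 * (1 - `|form u v|).
Proof.
move=> c0 u1 v1 /=; set c := form u v.
have n0 : `|c| != 0 by rewrite normr_eq0.
have cuw : (c / `|c|)^* * c = `|c|.
  rewrite rmorphM fmorphV /= (CrealP (normr_real c)) mulrAC [_ * c]mulrC.
  by rewrite -normCK expr2 mulfK.
rewrite dnormB dnormZ u1 v1 linearZr_LR /= -/c cuw (CrealP (normr_real c)).
rewrite normf_div normr_id divff // expr1n mulr1; ring.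
Qed.

Lemma norm_sub_le (R : realType) (H : lmodType R[i]) (ip : H -> H -> R[i])
    (V : set H) (xi : H) (r : R) :
  (forall eta, V eta -> `|ip xi eta| <= r%:C%C) ->
  (norm_sub ip V xi <= r%:E)%E.
Proof.
move=> le_r; apply: ge_ereal_sup => _ [eta Veta <-].
by rewrite lee_fin modulus_le le_r.
Qed.

Theorem theorem2p3 (R : realType) (H : completeNormedModType R[i])
    (ip : {dot H for (@Num.conj R[i])})
    (ip_norm : forall xi : H, ip xi xi = `|xi| ^+ 2)
    (H_neq0 : exists xi : H, xi != 0)
    (V : set H)
    (V_sphere : V `<=` [set xi : H | `|xi| = 1])
    (V_closed : closed V)
    (V1 : forall lambda : R[i], `|lambda| = 1 ->
            [set lambda *: xi | xi in V] `<=` V)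
    (V2 : forall xi : H, (forall eta : H, V eta -> ip xi eta = 0) -> xi = 0) :
  forall xi : H, `|xi| = 1 ->
    (1 <= norm_sup ip V xi)%E /\ (norm_sup ip V xi = 1%E <-> V xi).
Proof.
move=> xi xi1.
have unitE (eta : H) : `|eta| = 1 -> ip eta eta = 1.
  by move=> eta1; rewrite ip_norm eta1 expr1n.
have sup_ge1 : (1 <= norm_sup ip V xi)%E.
  (* By Cauchy-Schwarz [xi] itself is in the unit ball of [norm_sub], and it pairs with itself to
     1. *)
  apply: ereal_sup_ubound; exists xi.
    by apply: norm_sub_le => eta /V_sphere eta1; rewrite dot_le1 ?unitE.
  by rewrite unitE // /modulus normr1.
split=> //; split=> [sup1|Vxi]; last first.
  apply/eqP; rewrite eq_le sup_ge1 andbT.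
  apply: ge_ereal_sup => _ [eta eta1 <-].
  (* Swapping the arguments preserves the modulus and makes [xi], now in [V], one of the test
     vectors in the supremum defining [norm_sub] at [eta]. *)
  rewrite lee_fin modulus_le hermC expr0 mul1r norm_conjC -modulus_le -lee_fin.
  by apply: le_trans eta1; apply: ereal_sup_ubound; exists xi.
(* If no [v] in [V] had [|<xi, v>| > r], then [xi / r] would lie in the unit
   ball of [norm_sub], whence [norm_sup xi >= 1 / r > 1]. *)
have near1 (r : R) : 0 < r < 1 -> exists2 v, V v & r%:C%C < `|ip xi v|.
  move=> /andP[r0 r1]; apply: contrapT => nex.
  have rC0 : 0 < r%:C%C :> R[i] by rewrite ltcR.
  have ball : (norm_sub ip V (r%:C%C^-1 *: xi) <= 1)%E.
    apply: norm_sub_le => v Vv.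
    rewrite linearZl_LR /= normrM normfV (gtr0_norm rC0).
    rewrite ler_pdivrMl // rmorph1 mulr1.
    rewrite real_leNgt ?normr_real ?gtr0_real //.
    by apply/negP => lt; apply: nex; exists v.
  have : (modulus (ip xi (r%:C%C^-1 *: xi)) <= 1)%R.
    by rewrite -lee_fin -sup1; apply: ereal_sup_ubound; exists (r%:C%C^-1 *: xi).
  rewrite modulus_le linearZr_LR /= unitE // mulr1 norm_conjC normfV (gtr0_norm rC0).
  by rewrite rmorph1 invf_le1 // lecR leNgt r1.
rewrite (closure_id V).1 // => B /nbhs_ballP[e /= e0 sB].
(* The radius [e] lives in [R[i]]; being positive it is real, so [t] can be chosen in [R]. *)
have eE : e = (complex.Re e)%:C%C by rewrite RRe_real ?gtr0_real.
set a := complex.Re e in eE; have a0 : 0 < a by rewrite -ltcR -eE.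
(* The bound [a^2 / 2] is what [|xi - w|^2 = 2 (1 - |<xi, v>|) < 2 t] requires to stay below [a^2];
   the bound [1/2] keeps [1 - t] inside [(0, 1)], as [near1] demands. *)
pose t := Num.min (2^-1) (a ^+ 2 / 2).
have t0 : 0 < t by rewrite lt_min invr_gt0 ltr0n divr_gt0 ?exprn_gt0.
have t1 : t < 1 by rewrite gt_min invf_lt1 ?ltr1n.
have [|v Vv ltv] := near1 (1 - t); first by rewrite subr_gt0 t1 gtrBl t0.
have c0 : ip xi v != 0.
  by rewrite -normr_gt0 (le_lt_trans _ ltv) // lecR subr_ge0 ltW.
set w := (ip xi v / `|ip xi v|) *: v.
exists w; split.
  apply: V1 (_ : `|ip xi v / `|ip xi v| | = 1) _ _; last by exists v.
  by rewrite normf_div normr_id divff ?normr_eq0.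
apply: sB; rewrite -ball_normE /= -(@ltr_pXn2r _ 2) ?nnegrE ?(ltW e0) //.
rewrite -ip_norm dot_rotate ?unitE //; last exact: V_sphere.
rewrite -ltr_pdivlMl // ltrBlDr -ltrBlDl (le_lt_trans _ ltv) //.
rewrite eE mulrC -(rmorph_nat (real_complex R)) -fmorphV -rmorphXn -rmorphM.
rewrite -(rmorph1 (real_complex R)) -rmorphB lecR.
by rewrite lerD2l lerN2 ge_min lexx orbT.
Qed.
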